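(* Let $A \in \mathbb{C}^{m \times n}$, let $r_1,\dots,r_m \in \mathbb{C}^n$ denote the conjugate transposes of the $m$ rows of $A$, let $v \in \mathbb{C}^n$ be a right singular vector of $A$ corresponding to its largest singular value (so $\|Av\|_2/\|v\|_2 = \|A\|_{2\to 2}$), and let $S = \{v, r_1, \dots, r_m\}$. Then for all $q \ge 2$, $$\max_{\substack{x \in S \\ x \ne 0}} \frac{\|Ax\|_q}{\|x\|_2} \;\ge\; \left(2m^{\frac{1}{q}}\right)^{-\frac{q-2}{2(q-1)}} \|A\|_{2\to q}.$$
   Context: For $A \in \mathbb{C}^{m\times n}$ and $p,q \in [1,\infty]$, the matrix $p\to q$ norm is $\|A\|_{p\to q} = \max_{x \in \mathbb{C}^n, x\neq 0} \|Ax\|_q/\|x\|_p$, where $\|\cdot\|_p$ is the usual $\ell_p$ norm on vectors. *)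

(* Defs.v *)
From HB Require Import structures.
From mathcomp Require Import all_boot all_order all_algebra.
From mathcomp Require Import spectral complex.
From mathcomp Require Import all_classical all_reals all_analysis.

Set Implicit Arguments.
Unset Strict Implicit.
Unset Printing Implicit Defensive.

Import Order.TTheory GRing.Theory Num.Theory.
Import ComplexField.Normc.

Local Open Scope classical_set_scope.
Local Open Scope ring_scope.
Local Open Scope complex_scope.
Local Open Scope sesquilinear_scope.

(* Only exponents 1 <= p <= +oo are meaningful; the value at -oo is junk. *)
Definition lpnorm (R : realType) (p : \bar R) (n : nat) (x : 'cV[R[i]]_n) : R :=
  match p with
  | r%:E => (\sum_(j < n) normc (x j 0) `^ r) `^ r^-1
  | +oo%E => \big[Num.max/0]_(j < n) normc (x j 0)
  | -oo%E => 0
  end.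

(* By finite dimensionality the set of ratios is bounded, and for 0 < n the
   supremum is attained, so it is the maximum. *)
Definition opnorm (R : realType) (p q : \bar R) (m n : nat)
    (A : 'M[R[i]]_(m, n)) : R :=
  sup [set lpnorm q (A *m x) / lpnorm p x | x in [set x : 'cV[R[i]]_n | x != 0]].

Definition right_singular_vector (R : realType) (m n : nat)
    (A : 'M[R[i]]_(m, n)) (s : R) (v : 'cV[R[i]]_n) : Prop :=
  [/\ 0 <= s, v != 0 & (A ^t* *m A) *m v = (s ^+ 2)%:C *: v].

Definition singular_value (R : realType) (m n : nat)
    (A : 'M[R[i]]_(m, n)) (s : R) : Prop :=
  exists v : 'cV[R[i]]_n, right_singular_vector A s v.

Definition largest_singular_value (R : realType) (m n : nat)
    (A : 'M[R[i]]_(m, n)) (s : R) : Prop :=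
  singular_value A s /\ forall t : R, singular_value A t -> t <= s.

Definition test_vectors (R : realType) (m n : nat)
    (A : 'M[R[i]]_(m, n)) (v : 'cV[R[i]]_n) : seq 'cV[R[i]]_n :=
  v :: [seq (row j A) ^t* | j <- enum 'I_m].

(* The exponent (q - 2) / (2 (q - 1)), extended to q = +oo by its limit. *)
Definition approx_exponent (R : realType) (q : \bar R) : R :=
  match q with
  | r%:E => (r - 2) / (2 * (r - 1))
  | _ => 1 / 2
  end.

(* Main.v *)
(** Let [M] be the maximum over the test vectors, and [y = A x] with [x] of
    Euclidean norm 1. Since [(A r_j)_j = |r_j|_2^2], every row has norm at most
    [M], so the columns [A r_j] of [A A^*] have l_q norm at most [M^2]. By
    duality and a symmetrisation this gives [|y|_(2q)^2 <= 2 M^2]. The power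
    mean inequality applied to [A v] gives [|y|_2 <= s <= m^(1/2 - 1/q) M]. Hoelder
    interpolation of [|y|_q] between these two bounds yields the constant. *)
Require Import Defs.
From HB Require Import structures.
From mathcomp Require Import all_boot all_order all_algebra.
From mathcomp Require Import spectral complex.
From mathcomp Require Import all_classical all_reals all_analysis.
From mathcomp Require Import ring lra.

Import Order.TTheory GRing.Theory Num.Theory.
Import ComplexField.Normc.
Local Open Scope ring_scope.
Local Open Scope complex_scope.
Local Open Scope sesquilinear_scope.

(** * Weighted Hoelder inequalities for finite real sums *)

Lemma weighted_am_gm (R : realType) (t a b : R) :
  0 <= t <= 1 -> 0 <= a -> 0 <= b ->
  a `^ t * b `^ (1 - t) <= t * a + (1 - t) * b.
Proof.
move=> /andP[t0 t1] a0 b0.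
have [->|tn0] := eqVneq t 0.
  by rewrite powRr0 subr0 powRr1// !mul1r mul0r add0r.
have [->|tn1] := eqVneq t 1.
  by rewrite subrr powRr0 powRr1// !mul1r mul0r addr0 mulr1.
have tp : 0 < t by rewrite lt_neqAle eq_sym tn0.
have tp1 : 0 < 1 - t by rewrite subr_gt0 lt_neqAle tn1.
(* Young's inequality with conjugate exponents 1/t and 1/(1-t), finite because the endpoints were
   split off. *)
have := @conjugate_powR R (a `^ t) (b `^ (1 - t)) t^-1 (1 - t)^-1.
rewrite !invr_gt0 !invrK -!powRrM !mulfV ?gt_eqF// !powRr1//.
rewrite ![_ * t]mulrC ![_ * (1 - t)]mulrC; apply => //; rewrite ?powR_ge0//.
by rewrite addrC subrK.
Qed.

(** Dividing by the two sums makes each total 1, and weighted AM-GM then applies termwise. With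
    weights t and 1-t, one form serves for duality, Cauchy-Schwarz, power means and
    interpolation. *)
Lemma hoelder_sum (R : realType) (I : finType) (P : pred I) (t : R)
    (a b : I -> R) :
  0 <= t <= 1 -> (forall i, 0 <= a i) -> (forall i, 0 <= b i) ->
  \sum_(i | P i) a i `^ t * b i `^ (1 - t)
    <= (\sum_(i | P i) a i) `^ t * (\sum_(i | P i) b i) `^ (1 - t).
Proof.
move=> t01 a0 b0; have /andP[t0 t1] := t01.
have [->|tn0] := eqVneq t 0.
  rewrite powRr0 mul1r subr0 powRr1 ?sumr_ge0//.
  by apply: ler_sum => i _; rewrite powRr0 mul1r powRr1.
have [->|tn1] := eqVneq t 1.
  rewrite subrr powRr0 mulr1 powRr1 ?sumr_ge0//.
  by apply: ler_sum => i _; rewrite powRr0 mulr1 powRr1.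
have tn1' : 1 - t != 0 by rewrite subr_eq0 eq_sym.
set sa := \sum_(i | P i) a i; set sb := \sum_(i | P i) b i.
have sa0 : 0 <= sa by apply: sumr_ge0.
have sb0 : 0 <= sb by apply: sumr_ge0.
have [sa_eq0|sa_neq0] := eqVneq sa 0.
  rewrite big1 ?mulr_ge0 ?powR_ge0// => i Pi.
  have /psumr_eq0P -> // : \sum_(i | P i) a i = 0 by [].
  by rewrite powR0// mul0r.
have [sb_eq0|sb_neq0] := eqVneq sb 0.
  rewrite big1 ?mulr_ge0 ?powR_ge0// => i Pi.
  have /psumr_eq0P -> // : \sum_(i | P i) b i = 0 by [].
  by rewrite powR0// mulr0.
have sap : 0 < sa by rewrite lt_neqAle eq_sym sa_neq0.
have sbp : 0 < sb by rewrite lt_neqAle eq_sym sb_neq0.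
have sum1 : \sum_(i | P i) (t * (a i / sa) + (1 - t) * (b i / sb)) = 1.
  by rewrite big_split/= -!mulr_sumr -!mulr_suml !divff// !mulr1 addrC subrK.
rewrite -[leRHS]mulr1 -[X in _ <= _ * X]sum1 mulr_sumr; apply: ler_sum => i _.
have -> : a i `^ t * b i `^ (1 - t) =
   (sa `^ t * sb `^ (1 - t)) * ((a i / sa) `^ t * (b i / sb) `^ (1 - t)).
  rewrite mulrACA -!powRM ?divr_ge0//.
  by rewrite ![_ * (_ / _)]mulrC !divfK.
rewrite ler_wpM2l ?mulr_ge0 ?powR_ge0//.
by apply: weighted_am_gm => //; rewrite divr_ge0.
Qed.

(* The terms with [y k <= y j] carry half of the symmetric sum; on them Hoelder
   is applied to each column and one power of [y k] is traded for [y j]. *)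
Lemma symmetric_form_le (R : realType) (I : finType) (q K : R)
    (t : I -> I -> R) (y : I -> R) :
  1 < q -> 0 <= K -> (forall j k, 0 <= t j k) -> (forall j k, t j k = t k j) ->
  (forall j, (\sum_k t k j `^ q) `^ q^-1 <= K) ->
  (forall j, 0 <= y j) ->
  \sum_j \sum_k y j `^ (2 * q - 1) * y k `^ (2 * q - 1) * t j k
    <= 2 * K * (\sum_j y j `^ (2 * q)) `^ (2 - q^-1).
Proof.
move=> q1 K0 t0 tC tK y0.
have q0 : 0 < q by lra.
have qn0 : q != 0 by rewrite gt_eqF.
have qm : q - 1 != 0 by rewrite gt_eqF// subr_gt0.
set S := \sum_j y j `^ (2 * q).
have S0 : 0 <= S by apply: sumr_ge0 => j _; exact: powR_ge0.
pose f j k := y j `^ (2 * q - 1) * y k `^ (2 * q - 1) * t j k.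
have f0 j k : 0 <= f j k by rewrite !mulr_ge0 ?powR_ge0.
have half : \sum_j \sum_(k | y k <= y j) f j k <= K * S `^ (2 - q^-1).
  (* One factor [S] is distributed over j, so that the bound can be proved for each j separately. *)
  have -> : S `^ (2 - q^-1) = S * S `^ (1 - q^-1).
    have : q^-1 < 1 by rewrite invf_lt1.
    move=> ?; rewrite -mulr_powRB1//; last by lra.
    by congr (_ * _ `^ _); ring.
  rewrite mulrCA {1}/S mulr_suml; apply: ler_sum => j _.
  have -> : \sum_(k | y k <= y j) f j k =
      y j `^ (2 * q - 1) * \sum_(k | y k <= y j) t k j * y k `^ (2 * q - 1).
    rewrite mulr_sumr; apply: eq_bigr => k _.
    by rewrite /f -mulrA [y k `^ _ * _]mulrC tC.
  have -> : y j `^ (2 * q) = y j `^ (2 * q - 1) * y j.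
    by rewrite [RHS]mulrC mulr_powRB1//; lra.
  rewrite -mulrA ler_wpM2l ?powR_ge0//.
  have q01 : 0 <= q^-1 <= 1 by rewrite invr_ge0 ltW//= invf_le1// ltW.
  (* Hoelder with exponents q and q/(q-1) separates column j of [t] from the powers of [y k]. *)
  have tb k : 0 <= t k j `^ q by exact: powR_ge0.
  have yb k : 0 <= y k `^ ((2 * q - 1) * (q / (q - 1))) by exact: powR_ge0.
  have := @hoelder_sum R I (fun k => y k <= y j) q^-1 _ _ q01 tb yb.
  under eq_bigr => k _.
    rewrite -powRrM mulfV// powRr1// -powRrM -mulrA.
    have -> : q / (q - 1) * (1 - q^-1) = 1 by field; rewrite qn0 qm.
    rewrite mulr1.
    over.
  move=> /le_trans; apply.
  rewrite mulrCA; apply: ler_pM; rewrite ?powR_ge0//.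
    apply: le_trans (tK j); apply: ge0_ler_powR.
    + by case/andP: q01.
    + by rewrite nnegrE sumr_ge0.
    + by rewrite nnegrE sumr_ge0.
    + by rewrite [leRHS](bigID (fun k => y k <= y j))/= lerDl sumr_ge0.
  have q1' : 0 <= 1 - q^-1 by rewrite subr_ge0; case/andP: q01.
  have -> : y j * S `^ (1 - q^-1) = (y j `^ (q / (q - 1)) * S) `^ (1 - q^-1).
    rewrite powRM ?powR_ge0// -powRrM.
    have -> : q / (q - 1) * (1 - q^-1) = 1 by field; rewrite qn0 qm.
    by rewrite powRr1.
  apply: ge0_ler_powR => //; rewrite ?nnegrE ?sumr_ge0 ?mulr_ge0 ?powR_ge0//.
  have Sle : \sum_(k | y k <= y j) y k `^ (2 * q) <= S.
    rewrite /S [leRHS](bigID (fun k => y k <= y j))/= lerDl sumr_ge0// => k _.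
    exact: powR_ge0.
  apply: le_trans (ler_wpM2l (powR_ge0 _ _) Sle).
  rewrite mulr_sumr; apply: ler_sum => k ykj.
  (* The surplus power q/(q-1) of [y k] is bounded by that of [y j]; the power 2q that remains sums
     to at most [S]. *)
  have -> : (2 * q - 1) * (q / (q - 1)) = q / (q - 1) + 2 * q by field.
  have qq0 : 0 < q / (q - 1) by rewrite divr_gt0// subr_gt0.
  rewrite powRD; last by rewrite gt_eqF// addr_gt0// mulr_gt0.
  rewrite ler_wpM2r ?powR_ge0//.
  by apply: ge0_ler_powR => //; rewrite ?nnegrE//; exact: ltW.
rewrite -/(f _ _).
have -> : 2 * K * S `^ (2 - q^-1) = K * S `^ (2 - q^-1) + K * S `^ (2 - q^-1).
  by rewrite -mulrA mulr_natl mulr2n.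
apply: le_trans (lerD half half).
(* By symmetry of [f] both orderings contribute equally. Together they cover all pairs; ties count
   twice, harmless since [f] is nonnegative. *)
have swap : \sum_j \sum_(k | y k <= y j) f j k
    = \sum_j \sum_(k | y j <= y k) f j k.
  rewrite (exchange_big_dep predT)//=.
  apply: eq_bigr => j _; apply: eq_bigr => k _.
  by rewrite /f [y j `^ _ * _]mulrC tC.
rewrite {2}swap -big_split/=; apply: ler_sum => j _.
rewrite (bigID (fun k => y k <= y j))/= lerD2l.
rewrite [leLHS]big_mkcond [leRHS]big_mkcond/=; apply: ler_sum => k _.
by rewrite -ltNge; case: ltgtP.
Qed.

(** * Complex moduli and the squared Euclidean norm *)

Lemma normc_ge0 (R : rcfType) (z : R[i]) : 0 <= normc z.
Proof. by case: z => a b; exact: sqrtr_ge0. Qed.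

Lemma complex_norm (R : rcfType) (z : R[i]) : `|z| = (normc z)%:C.
Proof. by case: z. Qed.

Lemma sqr_normcE (R : rcfType) (z : R[i]) : (normc z ^+ 2)%:C = z^* * z.
Proof. by rewrite rmorphXn/= -complex_norm mulrC; exact: normCK. Qed.

Lemma normc_conj (R : rcfType) (z : R[i]) : normc (z^*) = normc z.
Proof. by case: z => a b /=; rewrite sqrrN. Qed.

Lemma normc_sum (R : rcfType) (I : Type) (r : seq I) (F : I -> R[i]) :
  normc (\sum_(i <- r) F i) <= \sum_(i <- r) normc (F i).
Proof.
elim/big_ind2: _ => [|x a y b xa yb|//]; first by rewrite normc0.
by apply: le_trans (lerD xa yb); exact: le_normcD.
Qed.

(** Working with the square keeps exponents integral and matches the Hermitian form x^* x. *)
Definition sqn {R : realType} {n : nat} (x : 'cV[R[i]]_n) : R :=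
  \sum_(j < n) normc (x j 0) ^+ 2.

Lemma sqn_ge0 (R : realType) (n : nat) (x : 'cV[R[i]]_n) : 0 <= sqn x.
Proof. by apply: sumr_ge0 => j _; exact: sqr_ge0. Qed.

Lemma sqn_gt0 (R : realType) (n : nat) (x : 'cV[R[i]]_n) : x != 0 -> 0 < sqn x.
Proof.
move=> x0; rewrite lt_neqAle sqn_ge0 andbT eq_sym; apply: contra x0 => /eqP h.
apply/eqP/colP => j; rewrite mxE; apply: eq0_normc.
have /psumr_eq0P/(_ j isT)/eqP : sqn x = 0 by [].
by rewrite sqrf_eq0 => H; apply/eqP/H => i _; exact: sqr_ge0.
Qed.

Lemma sqnE (R : realType) (n : nat) (x : 'cV[R[i]]_n) :
  (sqn x)%:C = (x ^t* *m x) 0 0.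
Proof.
rewrite mxE rmorph_sum/=; apply: eq_bigr => j _.
by rewrite sqr_normcE !mxE.
Qed.

Lemma lpnorm2E (R : realType) (n : nat) (x : 'cV[R[i]]_n) :
  lpnorm 2%:E x = Num.sqrt (sqn x).
Proof.
rewrite /lpnorm powR12_sqrt; last by apply: sumr_ge0 => j _; exact: powR_ge0.
by congr Num.sqrt; apply: eq_bigr => j _; rewrite powR_mulrn ?normc_ge0.
Qed.

Lemma sqn_mulmx (R : realType) (m n : nat) (A : 'M[R[i]]_(m, n)) x :
  (sqn (A *m x))%:C = (x ^t* *m (A ^t* *m A) *m x) 0 0.
Proof. by rewrite sqnE trmx_mul map_mxM !mulmxA. Qed.

Lemma cauchy_schwarz_normc (R : realType) (n : nat) (u v : 'I_n -> R[i]) :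
  normc (\sum_i u i * v i) ^+ 2
    <= (\sum_i normc (u i) ^+ 2) * (\sum_i normc (v i) ^+ 2).
Proof.
set a := fun i => normc (u i) ^+ 2; set b := fun i => normc (v i) ^+ 2.
have a0 i : 0 <= a i by exact: sqr_ge0.
have b0 i : 0 <= b i by exact: sqr_ge0.
have h01 : 0 <= (2^-1 : R) <= 1 by apply/andP; split; lra.
have := @hoelder_sum R _ predT 2^-1 _ _ h01 a0 b0.
have -> : 1 - 2^-1 = 2^-1 :> R by lra.
rewrite !powR12_sqrt ?sumr_ge0// -sqrtrM ?sumr_ge0// => H.
rewrite -[leRHS]sqr_sqrtr; last first.
  by apply: mulr_ge0; apply: sumr_ge0 => i _; exact: sqr_ge0.
rewrite lerXn2r ?nnegrE ?normc_ge0 ?sqrtr_ge0//.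
apply: le_trans (normc_sum _ _ _ _) _; apply: le_trans H.
apply: ler_sum => i _.
by rewrite normcM !powR12_sqrt// !sqrtr_sqr !ger0_norm ?normc_ge0.
Qed.

(** * Spectral bound by the largest singular value *)

(** Singular values are defined by eigenvectors of A^* A, so the spectral theorem is needed: in an
    orthonormal eigenbasis the form |A x|^2 is diagonal with entries at most s^2. *)
Lemma sqn_mulmx_le (R : realType) (m n : nat) (A : 'M[R[i]]_(m, n)) (s : R) :
  largest_singular_value A s -> forall x, sqn (A *m x) <= s ^+ 2 * sqn x.
Proof.
move=> [_ smax] x; set H := A ^t* *m A.
have HH : H ^t* = H by rewrite /H trmx_mul map_mxM trmxCK.
have /orthomx_spectralP : H \is normalmx by apply/normalmxP; rewrite HH.
set P := spectralmx H; set d := spectral_diag H.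
have PU : P \is unitarymx by exact: spectral_unitarymx.
rewrite invmx_unitary// => HE.
have PPt : P *m P ^t* = 1%:M by apply/unitarymxP.
have PtP : P ^t* *m P = 1%:M.
  by rewrite -(invmx_unitary PU) mulVmx// unitarymx_unit.
(* The eigenvalue is |A u|^2 for the unit eigenvector [u], hence real and nonnegative, and its
   square root is a singular value. *)
have e_le i : exists2 e : R, d 0 i = e%:C & e <= s ^+ 2.
  pose u : 'cV_n := P ^t* *m delta_mx i 0.
  have Pu : P *m u = delta_mx i 0 by rewrite /u mulmxA PPt mul1mx.
  have Hu : H *m u = d 0 i *: u.
    rewrite {1}HE -!mulmxA Pu /u scalemxAr; congr (_ *m _).
    apply/colP => k; rewrite mul_diag_mx !mxE eqxx andbT.
    by have [->|_] := eqVneq k i; rewrite ?mulr0.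
  have u1 : sqn u = 1.
    apply: (@complexI R); rewrite /u sqn_mulmx trmxCK PPt mulmx1.
    rewrite -sqnE; congr (_%:C); rewrite /sqn (bigD1 i)//= mxE !eqxx normc1.
    rewrite expr1n big1 ?addr0// => j ji.
    by rewrite mxE (negbTE ji) normc0 expr0n.
  have dE : d 0 i = (sqn (A *m u))%:C.
    by rewrite sqn_mulmx -/H -mulmxA Hu -scalemxAr mxE -sqnE u1 mulr1.
  exists (sqn (A *m u)) => //.
  have le_s : Num.sqrt (sqn (A *m u)) <= s.
    apply: smax; exists u; split; rewrite ?sqrtr_ge0//.
      apply/eqP => u0; move: u1; rewrite u0 /sqn big1 => [/eqP|j _].
        by rewrite eq_sym oner_eq0.
      by rewrite mxE normc0 expr0n.
    by rewrite sqr_sqrtr ?sqn_ge0// -dE.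
  rewrite -[leLHS]sqr_sqrtr ?sqn_ge0// lerXn2r ?nnegrE ?sqrtr_ge0//.
  by apply: le_trans le_s; exact: sqrtr_ge0.
set z := P *m x.
have -> : sqn x = sqn z.
  apply: (@complexI R); rewrite /z sqn_mulmx PtP mulmx1; exact: sqnE.
have -> : sqn (A *m x) = \sum_j complex.Re (d 0 j) * normc (z j 0) ^+ 2.
  apply: (@complexI R); rewrite sqn_mulmx -/H {1}HE.
  have -> : x ^t* *m (P ^t* *m diag_mx d *m P) *m x = z ^t* *m (diag_mx d *m z).
    by rewrite /z trmx_mul map_mxM !mulmxA.
  rewrite mxE rmorph_sum/=; apply: eq_bigr => j _.
  have [e de _] := e_le j.
  rewrite de/= rmorphM/= sqr_normcE mul_diag_mx !mxE de; ring.
rewrite mulr_sumr; apply: ler_sum => j _.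
have [e -> es] := e_le j.
by rewrite ler_wpM2r ?sqr_ge0.
Qed.

(** * The bound with doubled exponent, by duality *)

Lemma normc_real (R : rcfType) (r : R) : 0 <= r -> normc r%:C = r.
Proof. by move=> r0; rewrite /normc/= expr0n addr0 sqrtr_sqr ger0_norm. Qed.

Lemma conjc_realM (R : rcfType) (r : R) (z : R[i]) : (r%:C * z)^* = r%:C * z^*.
Proof. by rewrite rmorphM/=; congr (_ * _); exact: conjc_real. Qed.

Lemma lpnorm_ge0 (R : realType) (q : \bar R) (n : nat) (x : 'cV[R[i]]_n) :
  0 <= lpnorm q x.
Proof. by case: q => [r||]//=; [exact: powR_ge0|exact: bigmax_ge_id]. Qed.

Lemma normc_entry_le_lpnorm (R : realType) (q : \bar R) (n : nat)
    (x : 'cV[R[i]]_n) (j : 'I_n) :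
  (0 < q)%E -> normc (x j 0) <= lpnorm q x.
Proof.
case: q => [r|_|]//=; last exact: le_bigmax.
rewrite lte_fin => r0.
have xr : normc (x j 0) = (normc (x j 0) `^ r) `^ r^-1.
  by rewrite -powRrM mulfV ?gt_eqF// powRr1 ?normc_ge0.
rewrite [leLHS]xr; apply: ge0_ler_powR; rewrite ?nnegrE ?powR_ge0//.
- by rewrite invr_ge0 ltW.
- by apply: sumr_ge0 => i _; exact: powR_ge0.
- rewrite (bigD1 j)//= lerDl; apply: sumr_ge0 => i _; exact: powR_ge0.
Qed.

(* Duality with [w j = y j |y j|^(2r-2)]: the pairing of [w] with [y = A x] is
   the sum on the left, and [|A^* w|_2^2] is a quadratic form in [A A^*]. *)
Lemma double_exponent_le (R : realType) (m n : nat) (A : 'M[R[i]]_(m, n))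
    (r K : R) (x : 'cV[R[i]]_n) :
  1 < r -> 0 <= K ->
  (forall j, (\sum_k normc ((A *m A ^t*) k j) `^ r) `^ r^-1 <= K) ->
  (\sum_j normc ((A *m x) j 0) `^ (2 * r)) `^ r^-1 <= 2 * K * sqn x.
Proof.
move=> r1 K0 AK; set y := A *m x; set Y := \sum_j _.
have r0 : 0 < r by lra.
have Y0 : 0 <= Y by apply: sumr_ge0 => j _; exact: powR_ge0.
pose w : 'cV[R[i]]_m := \col_j ((normc (y j 0) `^ (2 * r - 2))%:C * y j 0).
have wE j : w j 0 = (normc (y j 0) `^ (2 * r - 2))%:C * y j 0 by rewrite mxE.
have wtE j : (w ^t*) 0 j = (w j 0)^* by rewrite !mxE.
have wN j : normc (w j 0) = normc (y j 0) `^ (2 * r - 1).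
  rewrite wE normcM normc_real ?powR_ge0// mulrC.
  have -> : 2 * r - 2 = (2 * r - 1) - 1 by ring.
  by rewrite mulr_powRB1 ?normc_ge0//; lra.
have AC j k : normc ((A *m A ^t*) j k) = normc ((A *m A ^t*) k j).
  rewrite -normc_conj; congr (normc _).
  have {1}-> : A *m A ^t* = (A *m A ^t*) ^t* by rewrite trmx_mul map_mxM trmxCK.
  by rewrite !mxE; exact: conjCK.
have Yw : Y%:C = ((A ^t* *m w) ^t* *m x) 0 0.
  rewrite trmx_mul map_mxM trmxCK -mulmxA -/y mxE rmorph_sum/=.
  apply: eq_bigr => j _; rewrite wtE wE conjc_realM -mulrA -sqr_normcE.
  rewrite -rmorphM/=; congr (_%:C).
  rewrite -powR_mulrn ?normc_ge0// -powRD ?subrK//.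
  by apply/implyP => /eqP; lra.
(* The triangle inequality bounds w^* A A^* w by the symmetric form in the moduli of the entries of
   A A^*. *)
have AwE : sqn (A ^t* *m w) <= 2 * K * Y `^ (2 - r^-1).
  have ty j : 0 <= normc (y j 0) by exact: normc_ge0.
  have t0 j k : 0 <= normc ((A *m A ^t*) j k) by exact: normc_ge0.
  have := symmetric_form_le _ _ _ _ _ _ r1 K0 t0 AC AK ty.
  apply: le_trans.
  rewrite -[leLHS](normc_real _ _ (sqn_ge0 _ _ _)) sqn_mulmx trmxCK -mulmxA mxE.
  apply: le_trans (normc_sum _ _ _ _) _; apply: ler_sum => j _.
  rewrite normcM wtE normc_conj wN.
  under [leRHS]eq_bigr => k _ do rewrite -mulrA.
  rewrite -mulr_sumr ler_wpM2l ?powR_ge0//.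
  rewrite [(_ *m w) _ _]mxE.
  apply: le_trans (normc_sum _ _ _ _) _; apply: ler_sum => k _.
  by rewrite normcM wN mulrC.
have Y2 : Y ^+ 2 <= 2 * K * Y `^ (2 - r^-1) * sqn x.
  apply: le_trans (ler_wpM2r (sqn_ge0 _ _ _) AwE).
  rewrite -{1}(normc_real _ _ Y0) Yw mxE.
  apply: le_trans (cauchy_schwarz_normc _ _ _ _) _.
  rewrite ler_wpM2r ?sqn_ge0//; apply: ler_sum => i _.
  by rewrite [(_ ^t*) _ _]mxE normc_conj mxE.
have [->|Yn0] := eqVneq Y 0.
  by rewrite powR0 ?invr_eq0 ?gt_eqF// !mulr_ge0// sqn_ge0.
have Yp : 0 < Y by rewrite lt_neqAle eq_sym Yn0.
(* Cancelling Y^(2-1/r) from Y^2 leaves Y^(1/r). *)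
rewrite -(ler_pM2l (powR_gt0 (2 - r^-1) Yp)) -powRD ?Yn0 ?implybT// subrK.
by rewrite powR_mulrn// mulrA [Y `^ _ * _]mulrC.
Qed.

(** * Rows of A and the Gram matrix A A^* *)

Lemma mulmx_row_adjE (R : realType) (m n : nat) (A : 'M[R[i]]_(m, n)) j k :
  (A *m (row j A) ^t*) k 0 = (A *m A ^t*) k j.
Proof. by rewrite !mxE; apply: eq_bigr => i _; rewrite !mxE. Qed.

Lemma gram_diagE (R : realType) (m n : nat) (A : 'M[R[i]]_(m, n)) j :
  (A *m A ^t*) j j = (sqn ((row j A) ^t*))%:C.
Proof.
rewrite mxE rmorph_sum/=; apply: eq_bigr => i _.
by rewrite sqr_normcE !mxE; congr (_ * _); apply/esym; exact: conjCK.
Qed.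

(** Entry j of A r_j is |r_j|_2^2, which is thus at most M |r_j|_2; a nonzero factor |r_j|_2
    cancels. *)
Lemma sqrt_sqn_row_le (R : realType) (q : \bar R) (m n : nat)
    (A : 'M[R[i]]_(m, n)) (M : R) (j : 'I_m) :
  (0 < q)%E -> 0 <= M ->
  lpnorm q (A *m (row j A) ^t*) <= M * lpnorm 2%:E ((row j A) ^t*) ->
  Num.sqrt (sqn ((row j A) ^t*)) <= M.
Proof.
move=> q0 M0 /(le_trans (@normc_entry_le_lpnorm _ _ _ _ j q0)).
rewrite mulmx_row_adjE gram_diagE normc_real ?sqn_ge0// lpnorm2E.
set c := sqn _; have c0 : 0 <= c by exact: sqn_ge0.
rewrite -{1}(sqr_sqrtr c0) expr2.
have [->//|cn0] := eqVneq (Num.sqrt c) 0.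
by rewrite ler_pM2r// lt_neqAle eq_sym cn0 sqrtr_ge0.
Qed.

Lemma sqr_normc_entry_le (R : realType) (m n : nat) (A : 'M[R[i]]_(m, n)) x j :
  normc ((A *m x) j 0) ^+ 2 <= sqn ((row j A) ^t*) * sqn x.
Proof.
rewrite mxE; apply: le_trans (cauchy_schwarz_normc _ _ _ _) _.
rewrite ler_wpM2r ?sqn_ge0//; apply: ler_sum => i _.
by rewrite !mxE normc_conj.
Qed.

(** * Finite exponents: interpolation between l_2 and l_(2r) *)

(** Power mean inequality: Hoelder against the constant 1 with weight 2/r. *)
Lemma sqn_le_lpnorm (R : realType) (m : nat) (y : 'cV[R[i]]_m) (r : R) :
  2 <= r -> sqn y <= m%:R `^ (1 - 2 / r) * lpnorm r%:E y ^+ 2.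
Proof.
move=> r2; have r0 : 0 < r by lra.
have t01 : 0 <= 2 / r <= 1.
  by apply/andP; split; [apply: divr_ge0; lra|rewrite ler_pdivrMr ?mul1r].
have a0 j : 0 <= normc (y j 0) `^ r by exact: powR_ge0.
have b0 (j : 'I_m) : 0 <= (1 : R) by [].
rewrite [leRHS]mulrC -powR_mulrn ?lpnorm_ge0// /lpnorm -powRrM [r^-1 * _]mulrC.
have -> : m%:R = \sum_(j < m) (1 : R) by rewrite sumr_const card_ord.
apply: le_trans (@hoelder_sum R _ predT (2 / r) _ _ t01 a0 b0).
apply: ler_sum => j _.
rewrite powR1 mulr1 -powRrM mulrCA mulfV ?gt_eqF// mulr1.
by rewrite powR_mulrn ?normc_ge0.
Qed.

Lemma lpnorm_mulmx_le (R : realType) (m n : nat) (A : 'M[R[i]]_(m, n))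
    (s r M : R) (v x : 'cV[R[i]]_n) :
  largest_singular_value A s -> right_singular_vector A s v ->
  2 <= r -> 0 <= M ->
  lpnorm r%:E (A *m v) <= M * lpnorm 2%:E v ->
  (forall j,
    lpnorm r%:E (A *m (row j A) ^t*) <= M * lpnorm 2%:E ((row j A) ^t*)) ->
  lpnorm r%:E (A *m x)
    <= (2 * m%:R `^ r^-1) `^ approx_exponent r%:E * M * lpnorm 2%:E x.
Proof.
move=> hs [s0 v0 Hv] r2 M0 Mv Mr.
have r0 : 0 < r by lra.
have rn0 : r != 0 by rewrite gt_eqF.
have r10 : r - 1 != 0 by rewrite gt_eqF// subr_gt0; lra.
set X := sqn x; have X0 : 0 <= X by exact: sqn_ge0.
have s_le : s ^+ 2 <= m%:R `^ (1 - 2 / r) * M ^+ 2.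
  have vp := sqn_gt0 _ _ _ v0.
  have AvE : sqn (A *m v) = s ^+ 2 * sqn v.
    apply: (@complexI R); rewrite sqn_mulmx -mulmxA Hv -scalemxAr mxE -sqnE.
    by rewrite [RHS]rmorphM.
  rewrite -(ler_pM2r vp) -AvE; apply: le_trans (sqn_le_lpnorm _ _ _ _ r2) _.
  rewrite -mulrA ler_wpM2l ?powR_ge0//.
  have -> : M ^+ 2 * sqn v = (M * lpnorm 2%:E v) ^+ 2.
    by rewrite exprMn lpnorm2E sqr_sqrtr// ltW.
  by rewrite lerXn2r ?nnegrE ?mulr_ge0 ?lpnorm_ge0.
(* Column j of A A^* is A r_j, of norm at most M |r_j|_2, and |r_j|_2 is itself at most [M]. *)
have K_le j : (\sum_k normc ((A *m A ^t*) k j) `^ r) `^ r^-1 <= M ^+ 2.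
  have := Mr j; rewrite lpnorm2E /lpnorm.
  under eq_bigr => k _ do rewrite mulmx_row_adjE.
  move=> /le_trans; apply; rewrite expr2 ler_wpM2l//.
  by apply: sqrt_sqn_row_le M0 (Mr j); rewrite lte_fin.
set a := approx_exponent r%:E.
have aE : a = (r - 2) / (2 * (r - 1)) by [].
have a01 : 0 <= a <= 1.
  rewrite aE divr_ge0 ?mulr_ge0 ?subr_ge0//=; last by lra.
  by rewrite ler_pdivrMr ?mul1r ?mulr_gt0 ?subr_gt0//; lra.
have [a0 a1] := andP a01.
set y := A *m x.
have Y_le : (\sum_j normc (y j 0) `^ (2 * r)) `^ r^-1 <= 2 * M ^+ 2 * X.
  by apply: double_exponent_le => //; [lra|exact: sqr_ge0].
have Z_le : sqn y <= m%:R `^ (1 - 2 / r) * M ^+ 2 * X.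
  by apply: le_trans (sqn_mulmx_le _ _ _ _ _ hs x) _; rewrite ler_wpM2r.
(* The weight [a] solves r = 2r a + 2(1-a), which is the origin of [approx_exponent]. *)
have interp : \sum_j normc (y j 0) `^ r <=
    (\sum_j normc (y j 0) `^ (2 * r)) `^ a * sqn y `^ (1 - a).
  have y1 j : 0 <= normc (y j 0) `^ (2 * r) by exact: powR_ge0.
  have y2 j : 0 <= normc (y j 0) ^+ 2 by exact: sqr_ge0.
  apply: le_trans (@hoelder_sum R _ predT a _ _ a01 y1 y2).
  apply: ler_sum => j _; rewrite -powR_mulrn ?normc_ge0// -!powRrM -powRD.
    rewrite [X in _ `^ X <= _](_ : r = 2 * r * a + 2 * (1 - a))// aE.
    by field.
  by apply/implyP => /eqP; rewrite aE => h; exfalso; move: h; rewrite -aE; nra.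
set Y := \sum_j _ in Y_le interp.
have Y0 : 0 <= Y by apply: sumr_ge0 => j _; exact: powR_ge0.
have ra0 : 0 <= (1 - a) / r by rewrite divr_ge0 ?subr_ge0// ltW.
have step : lpnorm r%:E y <=
    (2 * M ^+ 2 * X) `^ a * (m%:R `^ (1 - 2 / r) * M ^+ 2 * X) `^ ((1 - a) / r).
  apply: (@le_trans _ _ ((Y `^ a * sqn y `^ (1 - a)) `^ r^-1)).
    apply: ge0_ler_powR => //.
    - by rewrite invr_ge0 ltW.
    - by rewrite nnegrE sumr_ge0// => j _; exact: powR_ge0.
    - by rewrite nnegrE mulr_ge0 ?powR_ge0.
  rewrite powRM ?powR_ge0// [_ `^ a `^ _]powRAC -[_ `^ _ `^ r^-1]powRrM.
  by apply: ler_pM; rewrite ?powR_ge0//; apply: ge0_ler_powR => //;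
    rewrite ?nnegrE ?sqn_ge0 ?mulr_ge0 ?powR_ge0 ?sqr_ge0.
apply: le_trans step _.
rewrite lpnorm2E -/X -powR12_sqrt//.
(* This identity gives [M] the total exponent 1 and [X] the exponent 1/2. *)
have half : a + (1 - a) / r = 2^-1 by rewrite aE; field; rewrite rn0 r10.
rewrite -!(powR_mulrn 2 M0) !powRM ?mulr_ge0 ?powR_ge0// -!powRrM.
(* The power of m becomes (m^(1/r))^a, which joins 2^a in the constant. *)
have -> : (1 - 2 / r) * ((1 - a) / r) = r^-1 * a.
  by rewrite aE; field; rewrite rn0 r10.
have MM : M `^ (2 * a) * M `^ (2 * ((1 - a) / r)) = M.
  by rewrite -powRD -mulrDr half divff ?powRr1 ?oner_eq0.
have XX : X `^ a * X `^ ((1 - a) / r) = X `^ 2^-1.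
  by rewrite -powRD half// invr_eq0 pnatr_eq0.
rewrite -{3}MM -XX le_eqVlt; apply/orP; left; apply/eqP; ring.
Qed.

(** * The infinite exponent and the conclusion *)

(** No interpolation loss occurs here: |(A x)_j| <= |r_j|_2 |x|_2 <= M |x|_2 by Cauchy-Schwarz. *)
Lemma lpnorm_oo_mulmx_le (R : realType) (m n : nat) (A : 'M[R[i]]_(m, n))
    (M : R) (x : 'cV[R[i]]_n) :
  0 <= M ->
  (forall j,
    lpnorm +oo (A *m (row j A) ^t*) <= M * lpnorm 2%:E ((row j A) ^t*)) ->
  lpnorm +oo (A *m x) <= M * lpnorm 2%:E x.
Proof.
move=> M0 Mr; rewrite lpnorm2E.
have MX : 0 <= M * Num.sqrt (sqn x) by rewrite mulr_ge0 ?sqrtr_ge0.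
apply: bigmax_le => // j _.
rewrite -(@ler_pXn2r _ 2) ?nnegrE ?normc_ge0//.
apply: le_trans (sqr_normc_entry_le _ _ _ _ _ _) _.
rewrite exprMn sqr_sqrtr ?sqn_ge0// ler_wpM2r ?sqn_ge0//.
rewrite -[leLHS]sqr_sqrtr ?sqn_ge0// lerXn2r ?nnegrE ?sqrtr_ge0//.
exact: sqrt_sqn_row_le M0 (Mr j).
Qed.

(* The maximum over the nonzero x in S is a big max with unit 0: all ratios are
   nonnegative and S contains the nonzero vector v. At q = +oo, 1 / q is 0. *)
Theorem theorem1 (R : realType) (m n : nat) (A : 'M[R[i]]_(m, n))
    (s : R) (v : 'cV[R[i]]_n)
    (hs : largest_singular_value A s) (hv : right_singular_vector A s v)
    (q : \bar R) (hq : (2%:E <= q)%E) :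
  \big[Num.max/0]_(x <- test_vectors A v | x != 0)
      (lpnorm q (A *m x) / lpnorm 2%:E x)
  >= (2 * m%:R `^ (fine (q^-1)%E)) `^ (- approx_exponent q) * opnorm 2%:E q A.
Proof.
set M := \big[_/_]_(_ <- _ | _) _.
have M0 : 0 <= M by exact: bigmax_ge_id.
have q0 : (0 < q)%E by apply: lt_le_trans hq; rewrite lte_fin.
have norm2_gt0 (x : 'cV[R[i]]_n) : x != 0 -> 0 < lpnorm 2%:E x.
  by move=> x0; rewrite lpnorm2E sqrtr_gt0 sqn_gt0.
have lpnorm0 k : lpnorm q (0 : 'cV[R[i]]_k) = 0.
  case: q q0 {hq M M0} => [r||]//=.
    rewrite lte_fin => r0; rewrite big1 ?powR0 ?invr_eq0 ?gt_eqF// => j _.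
    by rewrite mxE normc0 powR0// gt_eqF.
  move=> _; apply/eqP; rewrite eq_le bigmax_ge_id andbT.
  by apply: bigmax_le => // j _; rewrite mxE normc0.
(* In product form the bound also covers zero rows, which the maximum skips. *)
have M_ge x : x \in test_vectors A v -> lpnorm q (A *m x) <= M * lpnorm 2%:E x.
  move=> xS; have [->|x0] := eqVneq x 0.
    by rewrite mulmx0 lpnorm0 mulr_ge0// lpnorm_ge0.
  rewrite -ler_pdivrMr ?norm2_gt0//.
  exact: (Order.TotalTheory.le_bigmax_seq _ _ _
    (fun z => lpnorm q (A *m z) / lpnorm 2%:E z) xS x0).
have Mv : lpnorm q (A *m v) <= M * lpnorm 2%:E v.
  by apply: M_ge; rewrite inE eqxx.
have Mr j : lpnorm q (A *m (row j A) ^t*) <= M * lpnorm 2%:E ((row j A) ^t*).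
  apply: M_ge; rewrite in_cons; apply/orP; right.
  by apply: (map_f (fun i => (row i A) ^t*)); rewrite mem_enum.
have op_le (C : R) :
    (forall x, lpnorm q (A *m x) <= C * lpnorm 2%:E x) -> opnorm 2%:E q A <= C.
  move=> AC; apply: ge_sup.
    by exists (lpnorm q (A *m v) / lpnorm 2%:E v); exists v => //; case: hv.
  by move=> _ [x x0 <-]; rewrite ler_pdivrMr; [exact: AC|exact: norm2_gt0].
(* For m = 0 the constant may vanish and cannot be divided by, but every A x is 0. *)
have [m0|m0] := posnP m.
  apply: le_trans M0; rewrite mulr_ge0_le0 ?powR_ge0//; apply: op_le => x.
  rewrite mul0r; suff -> : A *m x = 0 by rewrite lpnorm0.
  by apply/colP => j; have := ltn_ord j; rewrite {2}m0.
have mp : 0 < m%:R :> R by rewrite ltr0n.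
have Cp : 0 < (2 * m%:R `^ fine q^-1) `^ approx_exponent q.
  by rewrite powR_gt0// mulr_gt0// powR_gt0.
rewrite powRN mulrC ler_pdivrMr// mulrC; apply: op_le => x.
clearbody M; clear norm2_gt0 lpnorm0 M_ge Cp.
case: q hq q0 Mv Mr => [r||] hq q0 Mv Mr.
- rewrite fine_invr; move: hq; rewrite lee_fin => hq.
  exact: lpnorm_mulmx_le hs hv hq M0 Mv Mr.
- apply: le_trans (lpnorm_oo_mulmx_le _ _ _ _ _ _ M0 Mr) _.
  rewrite ler_wpM2r ?lpnorm_ge0// ler_peMl//.
  (* At q = +oo the power of m is 1, and the constant 2^(1/2) is at least 1. *)
  rewrite invey/= powRr0 mulr1 -[leLHS](powRr0 2).
  by apply: ler_powR; rewrite ?ler1n//; lra.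
- by exfalso; move: q0; rewrite ltNge leNye.
Qed.
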